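(* Consider a contracting action of $\mathbf{Z}$ on some non-compact, totally disconnected, locally compact group $H$. Then there exist an integer $r\ge 3$ and a proper length function $\ell$ on the semidirect product $G=\mathbf{Z}\ltimes H$ such that the pseudo-metric space $(G,d)$, where $d(g,g')=\ell(g^{-1}g')$, is isometric to the vertex set of an $r$-regular tree.
   Context: Let $\mathbf{Z}$ act by (topological) automorphisms on a locally compact group $H$. A vacuum subset is a subset $U\subset H$ such that for every compact $M\subset H$ one has $k\cdot M\subset U$ for all large enough $k$. The action is contracting if there is a compact vacuum subset. A length function on a group $G$ is a function $\ell:G\to[0,\infty)$ with $\ell(1)=0$, $\ell(g^{-1})=\ell(g)$ and $\ell(gh)\le\ell(g)+\ell(h)$; on a locally compact group it is proper if the subsets $\{\ell\le n\}$ are relatively compact for all $n$. A pseudo-metric space is isometric to a metric space $T$ if the metric space obtained by identifying points at distance $0$ is isometric to $T$. The vertex set of a tree carries the combinatorial distance. *)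

(* Defs.v *)
From HB Require Import structures.
From mathcomp Require Import all_boot all_order all_algebra.
From mathcomp Require Import generic_quotient.
From mathcomp Require Import all_classical all_reals all_analysis.

Set Implicit Arguments.
Unset Strict Implicit.
Unset Printing Implicit Defensive.

Import Order.TTheory GRing.Theory Num.Theory.
Import Algebra.

Local Open Scope classical_set_scope.
Local Open Scope ring_scope.
Local Open Scope quotient_scope.

HB.mixin Record isTopGroup G of Group G & Topological G := {
  mulg_continuous : continuous (fun xy : G * G => (xy.1 * xy.2)%g);
  invg_continuous : continuous (fun x : G => x^-1%g);
}.

#[short(type="topGroupType")]
HB.structure Definition TopGroup :=
  {G of isTopGroup G & Group G & Topological G}.

(* Each [act k] is bijective with continuous inverse [act (- k)], hence a
   topological automorphism. *)
Record zaction (H : topGroupType) := ZAction {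
  zact :> int -> H -> H;
  zact0 : forall h, zact 0 h = h;
  zactD : forall k l h, zact (k + l) h = zact k (zact l h);
  zactM : forall k, {morph zact k : g h / (g * h)%g >-> (g * h)%g};
  zact_continuous : forall k, continuous (zact k);
}.

Definition vacuum (H : topGroupType) (a : zaction H) (U : set H) :=
  forall M : set H, compact M ->
    exists N : int, forall k : int, N <= k -> a k @` M `<=` U.

Definition contracting (H : topGroupType) (a : zaction H) :=
  exists2 U : set H, compact U & vacuum a U.

(* The pair [(k, h)] stands for [h . k], where [k . h . k^-1 = a k h]. *)
Definition semidirect (H : topGroupType) (a : zaction H) : Type :=
  (int * H)%type.

Section Semidirect.
Variables (H : topGroupType) (a : zaction H).
Local Notation G := (semidirect a).

HB.instance Definition _ :=
  Topological.copy G (discrete_topology int * H)%type.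

Definition sd_one : G := (0, 1%g).
Definition sd_mul (x y : G) : G := (x.1 + y.1, (x.2 * a x.1 y.2)%g).
Definition sd_inv (x : G) : G := (- x.1, a (- x.1) x.2^-1%g).

Lemma zact1 k : a k 1%g = 1%g.
Proof. by apply: (mulgI (a k 1%g)); rewrite -zactM !mulg1. Qed.

Lemma sd_mulA : associative sd_mul.
Proof.
by move=> x y z; rewrite /sd_mul /= addrA zactD zactM mulgA.
Qed.

Lemma sd_mul1 : left_id sd_one sd_mul.
Proof. by move=> [k h]; rewrite /sd_mul /= add0r zact0 mul1g. Qed.

Lemma sd_mulr1 : right_id sd_one sd_mul.
Proof. by move=> [k h]; rewrite /sd_mul /= addr0 zact1 mulg1. Qed.

Lemma sd_mulV : left_inverse sd_one sd_inv sd_mul.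
Proof.
move=> [k h]; rewrite /sd_mul /sd_inv /=.
by rewrite addNr -zactM mulVg zact1.
Qed.

Lemma sd_mulrV : right_inverse sd_one sd_inv sd_mul.
Proof.
move=> [k h]; rewrite /sd_mul /sd_inv /=.
by rewrite -zactD subrr zact0 mulgV.
Qed.

HB.instance Definition _ :=
  isGroup.Build G sd_mulA sd_mul1 sd_mulr1 sd_mulV sd_mulrV.

Let pi1 (x : G) : discrete_topology int := x.1.
Let pi2 (x : G) : H := x.2.

Let cvg_pi1 (x : G) : pi1 y @[y --> x] --> pi1 x.
Proof. by case: x => k h; exact: cvg_fst. Qed.

Let cvg_pi2 (x : G) : pi2 y @[y --> x] --> pi2 x.
Proof. by case: x => k h; exact: cvg_snd. Qed.

Let near_pi1 (x : G) : \forall y \near x, pi1 y = pi1 x.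
Proof. exact: (cvg_pi1 (discrete_set1 _)). Qed.

Lemma sd_mul_continuous : continuous (fun xy : G * G => (xy.1 * xy.2)%g).
Proof.
move=> [x y].
have c1 : z.1 @[z --> (x, y)] --> x by exact: cvg_fst.
have c2 : z.2 @[z --> (x, y)] --> y by exact: cvg_snd.
have n1 : \forall z \near (x, y), pi1 z.1 = pi1 x.
  exact: (c1 _ (near_pi1 x)).
have n2 : \forall z \near (x, y), pi1 z.2 = pi1 y.
  exact: (c2 _ (near_pi1 y)).
have e1 : (pi1 z.1 + pi1 z.2 : discrete_topology int) @[z --> (x, y)]
    --> (pi1 x + pi1 y : discrete_topology int).
  apply/discrete_cvg; apply: filterS2 n1 n2 => z /= -> ->; exact: erefl.
have e2 : (pi2 z.1 * a (pi1 z.1) (pi2 z.2))%g @[z --> (x, y)]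
    --> (pi2 x * a (pi1 x) (pi2 y))%g.
  have c : (pi2 z.1 * a (pi1 x) (pi2 z.2))%g @[z --> (x, y)]
      --> (pi2 x * a (pi1 x) (pi2 y))%g.
    apply: (@continuous2_cvg _ H H H _ _ (fun z : G * G => pi2 z.1)
      (fun z : G * G => a (pi1 x) (pi2 z.2)) (fun g h => g * h)%g).
    - exact: (@mulg_continuous H (_, _)).
    - exact: (@continuous_cvg _ G H _ _ _ pi2 _ (cvg_pi2 (x := x)) c1).
    apply: continuous_cvg; first exact: zact_continuous.
    exact: (@continuous_cvg _ G H _ _ _ pi2 _ (cvg_pi2 (x := y)) c2).
  apply: cvg_trans c; apply: near_eq_cvg; near=> z => /=.
  by have -> : pi1 z.1 = pi1 x by near: z.
exact: (cvg_pair e1 e2).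
Unshelve. all: by end_near. Qed.

Lemma sd_inv_continuous : continuous (fun x : G => x^-1%g).
Proof.
move=> x.
have e1 : (- pi1 z : discrete_topology int) @[z --> x]
    --> (- pi1 x : discrete_topology int).
  apply/discrete_cvg; apply: filterS (near_pi1 x) => z /= ->; exact: erefl.
have e2 : a (- pi1 z) (pi2 z)^-1%g @[z --> x] --> a (- pi1 x) (pi2 x)^-1%g.
  have c : a (- pi1 x) (pi2 z)^-1%g @[z --> x] --> a (- pi1 x) (pi2 x)^-1%g.
    apply: continuous_cvg; first exact: zact_continuous.
    apply: continuous_cvg; first exact: invg_continuous.
    exact: cvg_pi2.
  apply: cvg_trans c; apply: near_eq_cvg; near=> z => /=.
  by have -> : pi1 z = pi1 x by near: z; exact: near_pi1.
exact: (cvg_pair e1 e2).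
Unshelve. all: by end_near. Qed.

HB.instance Definition _ :=
  isTopGroup.Build G sd_mul_continuous sd_inv_continuous.

End Semidirect.

Record length_function (R : realType) (G : groupType) := LengthFunction {
  len :> G -> R;
  len_ge0 : forall g, 0 <= len g;
  len1 : len 1%g = 0;
  lenV : forall g, len g^-1%g = len g;
  lenM : forall g h, len (g * h)%g <= len g + len h;
}.

Definition proper_length (R : realType) (G : topGroupType)
    (l : length_function R G) :=
  forall n : nat, precompact [set g : G | l g <= n%:R].

Record pseudodist (R : realType) (X : Type) := PseudoDist {
  pdist :> X -> X -> R;
  pdist_ge0 : forall x y, 0 <= pdist x y;
  pdistxx : forall x, pdist x x = 0;
  pdist_sym : forall x y, pdist x y = pdist y x;
  pdist_triangle : forall y x z, pdist x z <= pdist x y + pdist y z;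
}.

Section LeftDist.
Variables (R : realType) (G : groupType) (l : length_function R G).

Definition left_dist_fun (g g' : G) : R := l (g^-1 * g')%g.

Lemma left_dist_ge0 g g' : 0 <= left_dist_fun g g'.
Proof. exact: len_ge0. Qed.

Lemma left_distxx g : left_dist_fun g g = 0.
Proof. by rewrite /left_dist_fun mulVg len1. Qed.

Lemma left_dist_sym g g' : left_dist_fun g g' = left_dist_fun g' g.
Proof. by rewrite /left_dist_fun -lenV invgM invgK. Qed.

Lemma left_dist_triangle h g g' :
  left_dist_fun g g' <= left_dist_fun g h + left_dist_fun h g'.
Proof.
rewrite /left_dist_fun (_ : g^-1 * g' = (g^-1 * h) * (h^-1 * g'))%g ?lenM//.
by rewrite -mulgA mulVKg.
Qed.

Definition left_dist : pseudodist R G :=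
  PseudoDist left_dist_ge0 left_distxx left_dist_sym left_dist_triangle.

End LeftDist.

Section MetricQuotient.
Variables (R : realType) (X : choiceType) (d : pseudodist R X).

Definition dist0 : rel X := fun x y => d x y == 0.

Lemma dist0_refl : reflexive dist0.
Proof. by move=> x; rewrite /dist0 pdistxx. Qed.

Lemma dist0_sym : symmetric dist0.
Proof. by move=> x y; rewrite /dist0 pdist_sym. Qed.

Lemma dist0_trans : transitive dist0.
Proof.
move=> y x z /eqP xy /eqP yz; rewrite /dist0 eq_le pdist_ge0 andbT.
by have := pdist_triangle d y x z; rewrite xy yz addr0.
Qed.

Canonical dist0_equiv := EquivRel dist0 dist0_refl dist0_sym dist0_trans.

Definition metric_quotient : Type := {eq_quot dist0_equiv}.

HB.instance Definition _ :=
  Choice.copy metric_quotient {eq_quot dist0_equiv}.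

Definition mq_dist (u v : metric_quotient) : R :=
  d (repr (u : {eq_quot dist0_equiv})) (repr (v : {eq_quot dist0_equiv})).

Lemma mq_distxx u : mq_dist u u = 0. Proof. exact: pdistxx. Qed.

Lemma mq_dist_eq0 u v : mq_dist u v = 0 -> u = v.
Proof.
move=> uv; rewrite -[u](@reprK _ {eq_quot dist0_equiv}).
by rewrite -[v](@reprK _ {eq_quot dist0_equiv}); apply/eqmodP/eqP.
Qed.

Lemma mq_dist_sym u v : mq_dist u v = mq_dist v u.
Proof. exact: pdist_sym. Qed.

Lemma mq_dist_triangle v u w : mq_dist u w <= mq_dist u v + mq_dist v w.
Proof. exact: pdist_triangle. Qed.

HB.instance Definition _ := isMetric.Build R metric_quotient
  mq_distxx mq_dist_eq0 mq_dist_sym mq_dist_triangle.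

Definition mq_pi (x : X) : metric_quotient := \pi_{eq_quot dist0_equiv} x.

(* The distance on the quotient does not depend on the representatives. *)
Lemma mdist_mq_pi (x y : X) : mdist (mq_pi x) (mq_pi y) = d x y.
Proof.
have r z : d (repr (\pi_{eq_quot dist0_equiv} z)) z = 0.
  suff : dist0_equiv (repr (\pi_{eq_quot dist0_equiv} z)) z by move=> /eqP.
  by apply/eqmodP; rewrite reprK.
suff le u v u' v' : d u u' = 0 -> d v v' = 0 -> d u v <= d u' v'.
  have rV z : d z (repr (\pi_{eq_quot dist0_equiv} z)) = 0.
    by rewrite pdist_sym r.
  change (mq_dist (mq_pi x) (mq_pi y) = d x y).
  by apply/eqP; rewrite eq_le; apply/andP; split; apply: le;
    solve [exact: r | exact: rV].
move=> uu vv; have := pdist_triangle d u' u v.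
have := pdist_triangle d v' u' v; rewrite uu add0r (pdist_sym d v') vv addr0.
by move=> h1 h2; exact: le_trans h1.
Qed.

End MetricQuotient.

Record sgraph := SGraph {
  vertex :> choiceType;
  adj : rel vertex;
  adj_sym : symmetric adj;
  adj_irr : irreflexive adj;
}.

Definition walk (T : sgraph) (x y : T) (n : nat) : Prop :=
  exists p : seq T, [/\ path (@adj T) x p, last x p = y & size p = n].

Record tree := Tree {
  tree_graph :> sgraph;
  tree_nonempty : inhabited tree_graph;
  tree_connected : forall x y : tree_graph, exists n, walk x y n;
  tree_acyclic : forall c : seq tree_graph,
    (2 < size c)%N -> ~ ucycle (@adj tree_graph) c;
}.

Definition regular (r : nat) (T : sgraph) :=
  forall x : T, ([set y | adj x y] #= `I_r)%card.

Section TreeMetric.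
Variables (R : realType) (T : tree).

Lemma walk_exb (x y : T) : exists n, `[< walk x y n >].
Proof. by have [n w] := tree_connected x y; exists n; apply/asboolP. Qed.

Definition tree_dist (x y : T) : nat := ex_minn (walk_exb x y).

Lemma tree_distP (x y : T) : walk x y (tree_dist x y).
Proof. by rewrite /tree_dist; case: ex_minnP => n /asboolP. Qed.

Lemma tree_dist_le (x y : T) n : walk x y n -> (tree_dist x y <= n)%N.
Proof.
by rewrite /tree_dist; case: ex_minnP => m _ h w; apply: h; apply/asboolP.
Qed.

Lemma tree_distxx x : tree_dist x x = 0%N.
Proof. by apply/eqP; rewrite -leqn0 tree_dist_le//; exists [::]. Qed.

Lemma tree_dist_eq0 x y : tree_dist x y = 0%N -> x = y.
Proof.
move=> d0; have [p [_ pl]] := tree_distP x y; rewrite d0 => /size0nil p0.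
by move: pl; rewrite p0.
Qed.

Lemma walk_sym (x y : T) n : walk x y n -> walk y x n.
Proof.
move=> [p [xp <- <-]]; exists (rev (belast x p)); split.
- rewrite rev_path; apply: sub_path xp => u v; by rewrite adj_sym.
- by case: p {xp} => //= z p; rewrite rev_cons last_rcons.
- by rewrite size_rev size_belast.
Qed.

Lemma tree_dist_sym x y : tree_dist x y = tree_dist y x.
Proof.
by apply/eqP; rewrite eqn_leq !tree_dist_le//; apply/walk_sym/tree_distP.
Qed.

Lemma tree_dist_triangle y x z :
  (tree_dist x z <= tree_dist x y + tree_dist y z)%N.
Proof.
have [p [xp py <-]] := tree_distP x y; have [q [yq qz <-]] := tree_distP y z.
apply: tree_dist_le; exists (p ++ q).
by rewrite cat_path last_cat size_cat py xp yq.
Qed.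

Definition tree_vertices : Type := T.

HB.instance Definition _ := Choice.copy tree_vertices (vertex T).

Let tdist (x y : tree_vertices) : R := (tree_dist x y)%:R.

Let tdistxx x : tdist x x = 0. Proof. by rewrite /tdist tree_distxx. Qed.

Let tdist_eq0 x y : tdist x y = 0 -> x = y.
Proof. by move=> /eqP; rewrite pnatr_eq0 => /eqP/tree_dist_eq0. Qed.

Let tdist_sym x y : tdist x y = tdist y x.
Proof. by rewrite /tdist tree_dist_sym. Qed.

Let tdist_triangle y x z : tdist x z <= tdist x y + tdist y z.
Proof. by rewrite -natrD ler_nat tree_dist_triangle. Qed.

HB.instance Definition _ :=
  isMetric.Build R tree_vertices tdistxx tdist_eq0 tdist_sym tdist_triangle.

End TreeMetric.

Definition isometric (R : realType) (M N : metricType R) :=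
  exists f : M -> N, bijective f /\ forall x y, mdist (f x) (f y) = mdist x y.

(* Main.v *)
Require Import Defs.
From mathcomp Require Import all_boot all_order all_algebra.
From mathcomp Require Import generic_quotient zify.
From mathcomp Require Import all_classical all_reals all_analysis.

(* Let al be the automorphism by which the generator of Z acts and U a compact
   vacuum set with al^n U contained in U. The intersection W of the al^(nj) U is
   a compact subgroup, all of whose neighbourhoods are vacuum. If S is a compact
   open neighbourhood of 1, the stabilizer of W S under left translations is an
   open subgroup lying between W and W S, hence a compact open vacuum subgroup
   K0, and the elements of K0 with forward orbit in K0 form a compact open
   subgroup K with al K contained in K and H the union of the al^(-n) K. So G is an ascending HNN extension of K, with stable letter t = 1 in Z, and
   its Bass-Serre tree has vertex set G/K, with g K joined to its parent
   g t^-1 K. It is regular because G acts transitively, of finite degree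
   [K : al K] + 1 since al K is open in K, and of degree at least 3 since
   al K = K would make H = K compact. The length of g is the distance from K
   to g K. *)

Set Implicit Arguments.
Unset Strict Implicit.
Unset Printing Implicit Defensive.

Import Order.TTheory GRing.Theory Num.Theory.

Local Open Scope classical_set_scope.
Local Open Scope quotient_scope.
Local Open Scope group_scope.

(** * Compact open neighbourhoods in totally disconnected spaces *)

(** Clopen in the subspace C, expressed by closedness in T, which is the same for closed C. The
    intersection of these sets is the quasi-component of x in C. *)
Definition relative_clopen (T : topologicalType) (C : set T) (x : T) :
  set_system T := [set D | [/\ D x, D `<=` C, closed D & closed (C `\` D)]].

(** Each point of the compact set [C \ O] is avoided by some relatively clopen D. These sets are
    stable under finite intersection, so a single one avoids all of [C \ O]. *)
Lemma relative_clopen_nbhs (T : topologicalType) (C O : set T) (x : T) :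
  compact C -> closed C -> C x -> open O ->
  \bigcap_(D in relative_clopen C x) D `<=` O ->
  exists2 D, relative_clopen C x D & D `<=` O.
Proof.
move=> Ccpt Ccl Cx Oo QO; pose F := filter_from (relative_clopen C x) id.
have FF : Filter F.
  apply: filter_from_filter; first by exists C; split=> //;
    rewrite setDv; exact: closed0.
  move=> A B [Ax AC cA cCA] [Bx BC cB cCB]; exists (A `&` B) => //; split=> //.
  - by move=> y [/AC].
  - exact: closedI.
  - by rewrite setDIr; exact: closedU.
have PF : ProperFilter F by apply: filter_from_proper; move=> ? [? _]; exists x.
have /(iffLR (compact_near_coveringP _)) : compact (C `\` O).
  apply: (subclosed_compact _ Ccpt) => //.
  by rewrite setDE; apply: closedI => //; exact: open_closedC.
(* Near covering with subsets of T as indices, small along F; the predicate says that a point lies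
   outside the index set. *)
move=> /(_ _ _ setC (powerset_filter_from_filter PF))[].
  move=> y [Cy nOy].
  have [D [QD nDy]] : exists D, relative_clopen C x D /\ ~ D y.
    apply: contrapT => nD; apply: nOy; apply: QO => D QD.
    by apply: contrapT => nDy; apply: nD; exists D.
  have [Dx DC cD cCD] := QD.
  exists (~` D, [set U | U `<=` D]); first split.
  - by apply: open_nbhs_nbhs; split => //; exact: closed_openC.
  - apply/near_powerset_filter_fromP; first by move=> ? ?; exact: subset_trans.
    by exists D => //; exists D.
  - by case=> i j [? /subsetC]; apply.
move=> D [DF _ [E DE]] /(_ _ DE) EO.
have [D' QD' D'E] := DF _ DE; exists D' => // y D'y.
apply: contrapT => nOy; apply: (EO y); last exact: D'E.
by split=> //; case: QD' => _ + _ _; exact.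
Qed.

(* The ambient compact neighbourhood K provides the normality needed to separate
   the two closed pieces of a disconnection. *)
Lemma connected_relative_quasi_component (T : topologicalType)
    (K C : set T) (x : T) :
  hausdorff_space T -> compact K -> closed C -> C `<=` K° -> C x ->
  connected (\bigcap_(D in relative_clopen C x) D).
Proof.
move=> Th Kcpt Ccl CK Cx; set Q := \bigcap_(D in _) D.
have Ccpt : compact C.
  by apply: subclosed_compact Kcpt _ => // y /CK; exact: interior_subset.
have QC : Q `<=` C.
  by move=> y /(_ C); apply; split=> //; rewrite setDv; exact: closed0.
have Qcl : closed Q by apply: closed_bigI => D [].
have Qx : Q x by move=> D [].
(* It suffices to treat the piece of a disconnection that contains x; either piece may play that
   role. *)
suff side B B' : closed B -> closed B' -> Q = B `|` B' ->
    B `&` B' = set0 -> B x -> B' = set0.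
  move=> B B0 [U oU BU] [V cV BV].
  have cB : closed B by rewrite BV; exact: closedI.
  have cQB : closed (Q `\` B).
    have -> : Q `\` B = Q `&` ~` U.
      rewrite BU; apply/seteqP; split=> y /= [Qy]; first by move=> /not_andP[].
      by split=> // -[].
    by apply: closedI => //; exact: open_closedC.
  have BQ : B `<=` Q by rewrite BU => y [].
  have QE : Q = B `|` (Q `\` B) by rewrite setDUK.
  have [Bx|nBx] := pselect (B x).
    have := side _ _ cB cQB QE _ Bx; rewrite setDIK => /(_ erefl).
    by rewrite setD_eq0 => QB; apply/seteqP; split.
  have := side _ _ cQB cB _ _ (conj Qx nBx); rewrite setUC -QE setIC setDIK.
  by move=> /(_ erefl erefl) B00; case: B0 => y; rewrite B00.
move=> cB cB' QE BB' Bx.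
have BK : B `<=` K° by move=> y By; apply: CK; apply: QC; rewrite QE; left.
have nB : set_nbhs B (~` B').
  apply/set_nbhsP; exists (~` B'); split=> //; first exact: closed_openC.
  by move=> y By B'y; have : (B `&` B') y by []; rewrite BB'.
have [U BU UB'] := compact_normal_local Th Kcpt BK cB nB.
have /set_nbhsP[W [oW BW WU]] := BU.
have : Q `<=` W `|` ~` closure U.
  rewrite QE => y [/BW|B'y]; [by left|right => Uy].
  by have := UB' _ Uy.
move=> /(relative_clopen_nbhs Ccpt Ccl Cx)[].
  by apply: openU => //; apply: closed_openC; exact: closed_closure.
move=> D [Dx DC cD cCD] DU.
(* As D lies in [W] or outside [closure U], its traces on [closure U] and on [W] agree. This trace
   is therefore relatively clopen and contains x, so it contains Q, while [closure U] misses
   [B']. *)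
have QDU : Q `<=` D `&` closure U.
  move=> y; apply; split.
  + by split=> //; apply: subset_closure; apply: WU; exact: BW.
  + by move=> z [/DC].
  + by apply: closedI => //; exact: closed_closure.
  + have -> : C `\` (D `&` closure U) = (C `\` D) `|` (D `&` ~` W).
      apply/seteqP; split=> z /=.
        move=> [Cz /not_andP[nDz|nUz]]; first by left.
        have [Dz|] := pselect (D z); [right; split=> // Wz|by left].
        by apply: nUz; apply: subset_closure; exact: WU.
      move=> [[Cz nDz]|[Dz nWz]]; split=> //; [by case|exact: DC|].
      by move=> [_ Uz]; have [|] := DU z Dz.
    by apply: closedU => //; apply: closedI => //; exact: open_closedC.
apply/seteqP; split=> // y B'y.
have /QDU[_ /UB'] : Q y by rewrite QE; right.
exact.
Qed.

(** In a small compact neighbourhood [closure W] the quasi-component of x is connected, hence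
    reduced to x, so some relatively clopen set around x stays in the interior. *)
Lemma compact_open_nbhs (T : topologicalType) (x : T) :
  hausdorff_space T -> locally_compact [set: T] ->
  totally_disconnected [set: T] ->
  exists S : set T, [/\ compact S, open S & S x].
Proof.
move=> Th Tlc Ttd.
have [K0 K0x [K0cpt K0cl]] : compact_near (within [set: T] (nbhs x)).
  exact: Tlc.
have Kx : nbhs x K0.
  by move: K0x; rewrite /within /=; apply: filterS => y; exact.
have : nbhs x K0° by exact: nbhs_interior.
move=> /(compact_regular Th K0cpt Kx)[W Wx WK].
have Ccpt : compact (closure W).
  apply: subclosed_compact K0cpt _ => //; first exact: closed_closure.
  by move=> y /WK; exact: interior_subset.
have Cx : closure W x by apply: subset_closure; exact: nbhs_singleton.
have Qcon := connected_relative_quasi_component Th K0cpt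
  (@closed_closure _ W) WK Cx.
have Q1 : \bigcap_(D in relative_clopen (closure W) x) D `<=` (closure W)°.
  move=> y Qy; suff -> : y = x.
    by apply: filterS Wx; exact: subset_closure.
  have := Ttd x I; move=> /seteqP[+ _]; apply.
  exists (\bigcap_(D in relative_clopen (closure W) x) D) => //.
  by split=> // D [].
have [D [Dx DC cD cCD] DW] := relative_clopen_nbhs Ccpt
  (@closed_closure _ W) Cx (@open_interior _ _) Q1.
exists D; split=> //; first exact: subclosed_compact Ccpt _.
(* A relatively clopen set that avoids the boundary of [closure W] is open in T. *)
have -> : D = (closure W)° `&` ~` (closure W `\` D).
  apply/seteqP; split=> y.
    by move=> Dy; split; [exact: DW|case].
  move=> [/interior_subset Wy nWD]; apply: contrapT => nDy.
  exact: nWD.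
by apply: openI; [exact: open_interior|exact: closed_openC].
Qed.

(** * Compact open subgroups contracted by an action of Z *)

Definition subgroup (G : groupType) (S : set G) :=
  [/\ S 1, forall x y, S x -> S y -> S (x * y) & forall x, S x -> S x^-1].

Lemma cvg_mulg (H : topGroupType) (T : topologicalType) (z : T)
    (f g : T -> H) (x y : H) :
  f t @[t --> z] --> x -> g t @[t --> z] --> y ->
  (f t * g t) @[t --> z] --> x * y.
Proof.
apply: (@continuous2_cvg _ H H H _ _ f g (fun x y => x * y)).
exact: (@mulg_continuous H (x, y)).
Qed.

Lemma mulgl_continuous (H : topGroupType) (g : H) : continuous (fun x => g * x).
Proof. by move=> x; apply: cvg_mulg; [exact: cvg_cst|exact: cvg_id]. Qed.

Lemma nbhs_lcoset (H : topGroupType) (S : set H) (g : H) :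
  nbhs 1 S -> nbhs g [set x | S (g^-1 * x)].
Proof. by move=> S1; apply: mulgl_continuous; rewrite mulVg. Qed.

Lemma nbhs1_subgroup_open (H : topGroupType) (S : set H) :
  subgroup S -> nbhs 1 S -> open S.
Proof.
move=> [_ SM _] S1; rewrite openE => x Sx.
apply: filterS (nbhs_lcoset x S1) => y /= Sy.
by rewrite -(mulVKg x y); exact: SM.
Qed.

Lemma nbhs1_subgroup_closed (H : topGroupType) (S : set H) :
  subgroup S -> nbhs 1 S -> closed S.
Proof.
move=> [_ SM SV] S1; rewrite -openC openE => x nSx.
apply: filterS (nbhs_lcoset x S1) => y /= Sxy Sy; apply: nSx.
rewrite -[x](mulVKg y); apply: SM => //.
by rewrite -[x]invgK -invgM; exact: SV.
Qed.

Lemma compact_mulg (H : topGroupType) (A B : set H) :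
  compact A -> compact B -> compact [set xy.1 * xy.2 | xy in A `*` B].
Proof.
move=> Ac Bc; apply: continuous_compact; last exact: compact_setX.
by apply: continuous_subspaceT => x; exact: mulg_continuous.
Qed.

(** The condition on [h^-1] turns [h S] contained in S into [h S = S]; without it only a monoid
    would result. *)
Definition lstabilizer (G : groupType) (S : set G) :=
  [set h | forall s, S s -> S (h * s) /\ S (h^-1 * s)].

Lemma subgroup_lstabilizer (G : groupType) (S : set G) :
  subgroup (lstabilizer S).
Proof.
split=> [s Ss|x y Sx Sy s Ss|x Sx s /Sx[]]; last by rewrite invgK.
  by rewrite invg1 !mul1g.
have [Sys Syis] := Sy s Ss; have [_ Sxis] := Sx s Ss.
rewrite invgM -!mulgA; split; first by have [] := Sx _ Sys.
by have [] := Sy _ Sxis.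
Qed.

(** Continuity gives the condition for h near 1 and s near a given point of S; compactness of S
    makes the neighbourhood of 1 uniform in s. *)
Lemma nbhs1_lstabilizer (H : topGroupType) (S : set H) :
  compact S -> open S -> nbhs 1 (lstabilizer S).
Proof.
move=> /compact_near_coveringP Sc So.
apply: (Sc H (nbhs 1) (fun h s => S (h * s) /\ S (h^-1 * s)) _).
move=> s Ss.
have c1 : (z.2 * z.1) @[z --> (s, 1)] --> s.
  rewrite -[X in _ --> X]mul1g.
  by apply: cvg_mulg; [exact: cvg_snd|exact: cvg_fst].
have c2 : (z.2^-1 * z.1) @[z --> (s, 1)] --> s.
  rewrite -[X in _ --> X]mul1g; apply: cvg_mulg; last exact: cvg_fst.
  rewrite -[X in _ --> X]invg1; apply: continuous_cvg; last exact: cvg_snd.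
  exact: invg_continuous.
have Sn : nbhs s S by apply: open_nbhs_nbhs.
have n1 := c1 _ Sn; have n2 := c2 _ Sn.
by near=> z; split; near: z.
Unshelve. all: by end_near. Qed.

Section Contraction.
Variables (H : topGroupType) (a : zaction H).

Lemma zactV k x : a k x^-1 = (a k x)^-1.
Proof.
by apply: (mulgI (a k x)); rewrite -zactM !mulgV zact1.
Qed.

Lemma vacuum_core (U : set H) :
  hausdorff_space H -> compact U -> vacuum a U ->
  exists W : set H, [/\ compact W, subgroup W &
    forall O, open O -> W `<=` O -> vacuum a O].
Proof.
move=> Hh Uc Uv; have Ucl := compact_closed Hh Uc.
have [n n0 nU] : exists2 n : nat, (0 < n)%N &
    forall k : int, (n%:Z <= k)%R -> forall x, U x -> U (a k x).
  have [N NU] := Uv U Uc; exists `|N|.+1 => // k nk x Ux.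
  by apply: (NU k); [lia|exists x].
pose b (j : nat) : int := (- (n * j)%N%:Z)%R.
pose W := [set x | forall j, U (a (b j) x)].
(* Steps of length n make the sets [a (- b j) U] decrease, even if [a 1] does not map U into itself.
   Their intersection is W. *)
have Udec i j x : (i <= j)%N -> U (a (b j) x) -> U (a (b i) x).
  move=> ij Ux; move: ij; rewrite leq_eqVlt => /predU1P[->//|ij].
  have -> : b i = (- b j + b i + b j)%R by lia.
  by rewrite zactD; apply: nU => //; rewrite /b; nia.
have WU : W `<=` U by move=> x /(_ 0); rewrite /b muln0 oppr0 zact0.
(* An element with all its backward translates in a compact set M is
   contracted from arbitrarily far back, hence lies in W. *)
have absorb M z : compact M -> (forall j, M (a (b j) z)) -> W z.
  move=> /Uv[N NU] Mz j.
  have -> : b j = (- b `|N|%N + b (`|N| + j)%N)%R by rewrite /b; lia.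
  rewrite zactD; apply: (NU (- b `|N|%N)%R);
    last by exists (a (b (`|N| + j)%N) z).
  by rewrite /b; nia.
have Wcl : closed W.
  have -> : W = \bigcap_(j in setT) (a (b j) @^-1` U).
    by apply/seteqP; split=> x Wx j; [move=> _|]; exact: Wx.
  apply: closed_bigI => j _; apply: closed_comp => // x _.
  exact: zact_continuous.
exists W; split.
- exact: subclosed_compact Uc WU.
- split.
  + by apply: (absorb [set 1]) => [|j]; [exact: compact_set1|exact: zact1].
  + move=> x y Wx Wy; apply: absorb (compact_mulg Uc Uc) _ => j.
    exists (a (b j) x, a (b j) y); last by rewrite zactM.
    by split; [exact: Wx|exact: Wy].
  + move=> x Wx; apply: (absorb [set x^-1 | x in U]) => [|j].
      apply: continuous_compact Uc.
      by apply: continuous_subspaceT => y; exact: invg_continuous.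
    by exists (a (b j) x); [exact: Wx|rewrite zactV].
move=> O Oo WO M /Uv[N NU].
have : compact (U `\` O).
  apply: subclosed_compact Uc _ => //.
  by rewrite setDE; apply: closedI => //; exact: open_closedC.
move=> /compact_near_coveringP/(_ nat \oo (fun j x => ~ U (a (b j) x)) _)[].
  move=> x [Ux nOx].
  have [j nUj] : exists j, ~ U (a (b j) x).
    by apply: contrapT => nU'; apply/nOx/WO => j; apply: contrapT => nUj;
      apply: nU'; exists j.
  exists (a (b j) @^-1` (~` U), [set i | (j <= i)%N]).
    split => /=; last by exists j.
    apply: zact_continuous; apply: open_nbhs_nbhs; split=> //.
    exact: closed_openC.
  by move=> [y i] /= [nUy ji]; apply: contra_not nUy; exact: Udec.
(* The set [a (- b J) U] lies in U and misses [U \ O], hence lies in O. For k at least [N - b J] it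
   contains [a k M]. *)
move=> J _ /(_ J (leqnn J)) UO; exists (N - b J)%R => k Nk _ [m Mm <-].
have UJ : U (a (b J) (a k m)).
  by rewrite -zactD; apply: (NU (b J + k)%R); [lia|exists m].
apply: contrapT => nO; apply: (UO (a k m)) => //; split=> //.
by have := Udec 0%N J _ (leq0n _) UJ; rewrite /b muln0 oppr0 zact0.
Qed.

Lemma vacuum_open_subgroup :
  hausdorff_space H -> locally_compact [set: H] ->
  totally_disconnected [set: H] -> contracting a ->
  exists K : set H, [/\ compact K, closed K, nbhs 1 K, subgroup K & vacuum a K].
Proof.
move=> Hh Hlc Htd [U Uc Uv].
have [W [Wc [W1 WM WV] Wv]] := vacuum_core Hh Uc Uv.
have [S [Sc So S1]] := compact_open_nbhs 1 Hh Hlc Htd.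
pose S' := [set ws.1 * ws.2 | ws in W `*` S].
have S'c : compact S' by exact: compact_mulg.
have S'o : open S'.
  rewrite openE => _ [[w s] [/= Ww Ss] <-].
  have : nbhs (w * s) [set x | S (w^-1 * x)].
    by apply: mulgl_continuous; rewrite mulKg; exact: open_nbhs_nbhs.
  by apply: filterS => y /= Swy; exists (w, w^-1 * y) => //=; rewrite mulVKg.
pose K := lstabilizer S'.
have Kg : subgroup K := subgroup_lstabilizer S'.
have K1 : nbhs 1 K := nbhs1_lstabilizer S'c S'o.
have Kcl := nbhs1_subgroup_closed Kg K1.
exists K; split=> //.
  (* Since 1 is in [S'], every h in K satisfies [h = h * 1] in [S']. *)
  apply: subclosed_compact S'c _ => // h /(_ 1)[|].
    by exists (1, 1) => //=; rewrite mulg1.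
  by rewrite mulg1.
apply: Wv; first exact: nbhs1_subgroup_open.
move=> w Ww _ [[v s] [/= Wv' Ss] <-]; split.
  by exists (w * v, s); rewrite /= ?mulgA//; split=> //; exact: WM.
exists (w^-1 * v, s); rewrite /= ?mulgA//; split=> //.
by apply: WM => //; exact: WV.
Qed.

Lemma contracted_open_subgroup :
  hausdorff_space H -> locally_compact [set: H] ->
  totally_disconnected [set: H] -> contracting a ->
  exists K : set H, [/\ compact K, nbhs 1 K, subgroup K,
    forall x, K x -> K (a 1%R x) & forall x, exists n : nat, K (a n x)].
Proof.
move=> Hh Hlc Htd Hc.
have [K0 [K0c K0cl K01 [K0_1 K0M K0V] K0v]] :=
  vacuum_open_subgroup Hh Hlc Htd Hc.
have [N NK0] := K0v K0 K0c.
pose K := [set x | forall k : nat, K0 (a k x)].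
have KK0 : K `<=` K0 by move=> x /(_ 0%N); rewrite zact0.
have Kcl : closed K.
  have -> : K = \bigcap_(k in setT) (a (Posz k) @^-1` K0).
    by apply/seteqP; split=> x Kx k; [move=> _|]; exact: Kx.
  apply: closed_bigI => k _; apply: closed_comp => // x _.
  exact: zact_continuous.
exists K; split.
- exact: subclosed_compact K0c KK0.
(* Only finitely many conditions on x matter: beyond [|N|] the translates of K0 lie in K0, and the
   condition at 0 puts x in K0. *)
- have : \forall x \near (1 : H), forall k : 'I_`|N|.+1, K0 (a (k : nat) x).
    apply: filter_forall => k; apply: zact_continuous.
    by rewrite zact1.
  apply: filterS => x Kx k; have [kN|Nk] := ltnP k `|N|.+1.
    exact: (Kx (Ordinal kN)).
  apply: (NK0 k); first by lia.
  by exists x => //; have := Kx ord0; rewrite zact0.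
- split=> [k|x y Kx Ky k|x Kx k]; first by rewrite zact1.
    by rewrite zactM; exact: K0M.
  by rewrite zactV; exact: K0V.
- by move=> x Kx k; rewrite -zactD -PoszD addn1; exact: Kx.
- move=> x; have [M MK0] := K0v [set x] (@compact_set1 _ x).
  exists `|M|%N => k; rewrite -zactD; apply: (MK0 (k + `|M|%N)%R).
    by lia.
  by exists x.
Qed.

End Contraction.

(** * Trees defined by a parent function *)

Section ParentTree.
Variables (V : choiceType) (par : V -> V) (lev : V -> int) (v0 : V).
Hypothesis lev_par : forall v, lev (par v) = (lev v - 1)%R.
Hypothesis par_confluent :
  forall u v, exists m n, iter m par u = iter n par v.

Definition parent_adj : rel V := fun u v => (par u == v) || (par v == u).

Lemma parent_adj_sym : symmetric parent_adj.
Proof. by move=> u v; rewrite /parent_adj orbC. Qed.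

Lemma parent_adj_irr : irreflexive parent_adj.
Proof.
move=> v; apply/negbTE; rewrite /parent_adj orbb.
by apply/eqP => /(congr1 lev); rewrite lev_par; lia.
Qed.

Definition parent_graph := SGraph parent_adj_sym parent_adj_irr.

(** Climb from u to a common ancestor, then descend to v. *)
Lemma parent_graph_connected (u v : parent_graph) : exists n, walk u v n.
Proof.
have up w n : @walk parent_graph w (iter n par w) n.
  elim: n => [|n [p [wp pl sp]]]; first by exists [::].
  exists (rcons p (par (iter n par w))).
  by rewrite rcons_path wp pl last_rcons size_rcons sp /= /parent_adj eqxx.
have down w n : @walk parent_graph (iter n par w) w n.
  elim: n => [|n [p [wp pl sp]]]; first by exists [::].
  by exists (iter n par w :: p); rewrite /= wp sp /parent_adj eqxx orbT.
have [m [n e]] := par_confluent u v.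
have [p [up' pl _]] := up u m; have [q [vq ql _]] := down v n.
exists (size (p ++ q)), (p ++ q); rewrite cat_path last_cat.
by rewrite up' pl e vq ql.
Qed.

Lemma highest_vertex (c : seq V) : c != [::] ->
  exists2 v, v \in c & forall u, u \in c -> (lev u <= lev v)%R.
Proof.
elim: c => // w c IH _; have [->|/IH[v vc vmax]] := eqVneq c [::].
  by exists w; rewrite ?mem_head// => u; rewrite inE => /eqP->.
have [wv|vw] := leP (lev w) (lev v).
  exists v => [|u]; first by rewrite inE vc orbT.
  by rewrite inE => /predU1P[->//|/vmax].
exists w => [|u]; first exact: mem_head.
by rewrite inE => /predU1P[->//|/vmax/le_trans]; apply; exact: ltW.
Qed.

(* A highest vertex of a cycle has its parent as both of its neighbours. *)
Lemma parent_graph_acyclic (c : seq V) :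
  (2 < size c)%N -> ~ ucycle parent_adj c.
Proof.
move=> c2 /andP[cc uc].
have [|v vc vmax] := @highest_vertex c; first by case: (c) c2.
have lower u : u \in c -> parent_adj v u -> u = par v.
  move=> uc' /orP[/eqP->//|/eqP uv]; have := vmax u uc'.
  by rewrite -uv lev_par; lia.
have [i c' rc] := rot_to vc.
have mc' u : u \in c' -> u \in c.
  by move=> uc'; rewrite -(mem_rot i) rc inE uc' orbT.
move: uc cc c2; rewrite -(rot_uniq i) -(rot_cycle i) -(size_rot i) rc.
case: c' rc mc' => // w c'; case/lastP: c' => // c' u _ mc'.
rewrite /= rcons_path last_rcons => /and3P[_ + _] /and3P[vw _ uv] _.
have -> : w = par v by apply: lower => //; apply: mc'; exact: mem_head.
have -> : u = par v.
  apply: lower; last by rewrite parent_adj_sym.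
  by apply: mc'; rewrite inE mem_rcons mem_head orbT.
by rewrite mem_rcons mem_head.
Qed.

Definition parent_tree : tree :=
  @Tree parent_graph (inhabits v0) parent_graph_connected parent_graph_acyclic.

End ParentTree.

(** * Finiteness of balls and of locally constant images *)

Lemma finite_walk (T : sgraph) :
  (forall x : T, finite_set [set y | adj x y]) ->
  forall n (x : T), finite_set [set y | walk x y n].
Proof.
move=> fN; elim=> [|n IH] x.
  apply: sub_finite_set (finite_set1 x) => y [p [_ <- /size0nil ->]].
  by [].
apply: sub_finite_set (bigcup_finite (fN x) (fun z _ => IH z)).
move=> y [p [+ + +]]; case: p => // z p /= /andP[xz zp] py [sp].
by exists z => //; exists p.
Qed.

Lemma finite_tree_ball (T : tree) (x : T) n :
  (forall x : T, finite_set [set y | adj x y]) ->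
  finite_set [set y | (tree_dist x y <= n)%N].
Proof.
move=> fN.
apply: sub_finite_set
  (bigcup_finite (finite_II n.+1) (fun k _ => finite_walk fN k x)).
by move=> y yn; exists (tree_dist x y) => //; exact: tree_distP.
Qed.

Lemma tree_dist_morph (T : tree) (f : T -> T) (x y : T) :
  {homo f : x y / adj x y} -> (tree_dist (f x) (f y) <= tree_dist x y)%N.
Proof.
move=> fadj; have [p [xp py <-]] := tree_distP x y.
apply: tree_dist_le; exists (map f p); split.
- by rewrite path_map; apply: sub_path xp => u v /fadj.
- by rewrite last_map py.
- by rewrite size_map.
Qed.

Lemma compact_locally_constant_finite (T : topologicalType) (V : Type)
    (S : set T) (f : T -> V) :
  compact S -> (forall x, S x -> \forall y \near x, f y = f x) ->
  finite_set (f @` S).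
Proof.
move=> /compact_near_coveringP Sc fS.
(* Near covering, with the finite subsets of V growing as index filter. *)
pose F := filter_from finite_set (fun E0 : set V => [set E | E0 `<=` E]).
have FF : Filter F.
  apply: filter_from_filter; first by exists set0.
  move=> A B fA fB; exists (A `|` B); first by rewrite finite_setU.
  by move=> E /= ABE; split=> x ?; apply: ABE; [left|right].
have [|E0 fE0 /(_ E0 (@subset_refl _ _)) SE0] := Sc _ F (fun E y => E (f y)) FF.
  move=> x Sx; exists ([set y | f y = f x], [set E : set V | [set f x] `<=` E]).
    split; first exact: fS.
    by exists [set f x] => //; exact: finite_set1.
  by move=> [y E] /= [-> fxE]; exact: fxE.
by apply: sub_finite_set fE0 => _ [x Sx <-]; exact: SE0.
Qed.

(** * The Bass-Serre tree of an ascending HNN extension *)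

Section CosetTree.
Variables (G : groupType) (S : set G) (t : G) (lam : G -> int).
Hypothesis Sg : subgroup S.
Hypothesis tS : forall s, S s -> S (t * s * t^-1).
Hypothesis lamM : {morph lam : x y / x * y >-> (x + y)%R}.
Hypothesis lamS : forall s, S s -> lam s = 0%R.
Hypothesis lamt : lam t = 1%R.
Hypothesis S_absorbing : forall g, exists m n, S (t ^+ m * g * t ^- n).

Definition lcoset_rel : rel G := fun x y => `[< S (x^-1 * y) >].

Lemma lcoset_relP x y : reflect (S (x^-1 * y)) (lcoset_rel x y).
Proof. exact: asboolP. Qed.

Lemma lcoset_rel_refl : reflexive lcoset_rel.
Proof. by move=> x; apply/lcoset_relP; rewrite mulVg; case: Sg. Qed.

Lemma lcoset_rel_sym : symmetric lcoset_rel.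
Proof.
have SV x y : lcoset_rel x y -> lcoset_rel y x.
  move=> /lcoset_relP Sxy; apply/lcoset_relP; rewrite -[x]invgK -invgM.
  by case: Sg => _ _; apply.
by move=> x y; apply/idP/idP; exact: SV.
Qed.

Lemma lcoset_rel_trans : transitive lcoset_rel.
Proof.
move=> y x z /lcoset_relP Sxy /lcoset_relP Syz; apply/lcoset_relP.
by rewrite -(mulVKg y z) mulgA; case: Sg => _ SM _; exact: SM.
Qed.

Canonical lcoset_equiv :=
  EquivRel lcoset_rel lcoset_rel_refl lcoset_rel_sym lcoset_rel_trans.

Definition lcoset : choiceType := {eq_quot lcoset_equiv}.

Definition lcoset_pi (g : G) : lcoset := \pi_{eq_quot lcoset_equiv} g.

Definition lcoset_repr (u : lcoset) : G := repr (u : {eq_quot lcoset_equiv}).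

Lemma lcoset_reprK : cancel lcoset_repr lcoset_pi.
Proof. exact: (@reprK _ {eq_quot lcoset_equiv}). Qed.

Lemma lcoset_piP x y : lcoset_pi x = lcoset_pi y <-> S (x^-1 * y).
Proof.
split=> [xy|Sxy]; first by apply/lcoset_relP/(@eqmodP _ lcoset_equiv).
by apply/(@eqmodP _ lcoset_equiv)/lcoset_relP.
Qed.

Lemma lcoset_pi_repr x : S ((lcoset_repr (lcoset_pi x))^-1 * x).
Proof. by apply/lcoset_piP; rewrite lcoset_reprK. Qed.

Definition lcoset_par (u : lcoset) : lcoset := lcoset_pi (lcoset_repr u * t^-1).

(** The parent is independent of the representative: replacing g by [g * s] multiplies [g * t^-1] on
    the right by [t * s * t^-1], an element of S. *)
Lemma lcoset_par_pi g : lcoset_par (lcoset_pi g) = lcoset_pi (g * t^-1).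
Proof.
apply/lcoset_piP; rewrite invgM invgK mulgA -(mulgA t).
exact/tS/lcoset_pi_repr.
Qed.

Definition lcoset_lev (u : lcoset) : int := lam (lcoset_repr u).

Lemma lamV g : lam g^-1 = (- lam g)%R.
Proof.
have lam1 : lam 1 = 0%R by apply: lamS; case: Sg.
by have := lamM g g^-1; rewrite mulgV lam1; lia.
Qed.

Lemma lcoset_lev_pi g : lcoset_lev (lcoset_pi g) = lam g.
Proof.
by have := lamS (lcoset_pi_repr g); rewrite lamM lamV /lcoset_lev; lia.
Qed.

Lemma lcoset_lev_par u : lcoset_lev (lcoset_par u) = (lcoset_lev u - 1)%R.
Proof. by rewrite lcoset_lev_pi lamM lamV lamt. Qed.

Lemma iter_lcoset_par n g :
  iter n lcoset_par (lcoset_pi g) = lcoset_pi (g * t ^- n).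
Proof.
elim: n => [|n IH]; first by rewrite invg1 mulg1.
by rewrite iterS IH lcoset_par_pi expgS invgM mulgA.
Qed.

(** For cosets of g and h, [S_absorbing] at [g^-1 * h] says that the m-th ancestor of the first is
    the n-th ancestor of the second. *)
Lemma lcoset_par_confluent u v :
  exists m n, iter m lcoset_par u = iter n lcoset_par v.
Proof.
rewrite -[u]lcoset_reprK -[v]lcoset_reprK.
have [m [n Smn]] := S_absorbing ((lcoset_repr u)^-1 * lcoset_repr v).
exists m, n; rewrite !iter_lcoset_par; apply/lcoset_piP.
by rewrite invgM invgK -mulgA (mulgA _ _ (t ^- n)) mulgA.
Qed.

Definition lcoset_tree : tree :=
  parent_tree (lcoset_pi 1) lcoset_lev_par lcoset_par_confluent.

Definition lcoset_act (g : G) (u : lcoset) : lcoset :=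
  lcoset_pi (g * lcoset_repr u).

Lemma lcoset_act_pi g h : lcoset_act g (lcoset_pi h) = lcoset_pi (g * h).
Proof.
by apply/lcoset_piP; rewrite invgM -mulgA mulKg; exact: lcoset_pi_repr.
Qed.

Lemma lcoset_actK g : cancel (lcoset_act g) (lcoset_act g^-1).
Proof.
by move=> u; rewrite -[u]lcoset_reprK !lcoset_act_pi mulKg.
Qed.

Lemma lcoset_act_par g u :
  lcoset_par (lcoset_act g u) = lcoset_act g (lcoset_par u).
Proof.
by rewrite -[u]lcoset_reprK lcoset_act_pi !lcoset_par_pi lcoset_act_pi mulgA.
Qed.

Lemma lcoset_act_adj g (u v : lcoset) :
  parent_adj lcoset_par (lcoset_act g u) (lcoset_act g v) =
  parent_adj lcoset_par u v.
Proof.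
by rewrite /parent_adj !lcoset_act_par !(can_eq (lcoset_actK g)).
Qed.

Lemma lcoset_act_dist g (u v : lcoset_tree) :
  tree_dist (lcoset_act g u : lcoset_tree) (lcoset_act g v) = tree_dist u v.
Proof.
have le h (x y : lcoset_tree) :
    (tree_dist (lcoset_act h x : lcoset_tree) (lcoset_act h y)
       <= tree_dist x y)%N.
  apply: (@tree_dist_morph lcoset_tree (lcoset_act h)) => a b.
  by rewrite /= lcoset_act_adj.
apply/eqP; rewrite eqn_leq le /=.
by rewrite -{1}[u](lcoset_actK g) -{1}[v](lcoset_actK g) le.
Qed.

(** * The length function and its metric quotient *)

Variable R : realType.

Definition lcoset_len_fun (g : G) : R :=
  (tree_dist (lcoset_pi 1 : lcoset_tree) (lcoset_pi g))%:R%R.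

Lemma lcoset_len_funE g h :
  lcoset_len_fun (g^-1 * h) =
  (tree_dist (lcoset_pi g : lcoset_tree) (lcoset_pi h))%:R%R.
Proof.
by rewrite -(lcoset_act_dist g^-1) !lcoset_act_pi mulVg.
Qed.

Lemma lcoset_len_ge0 g : (0 <= lcoset_len_fun g)%R.
Proof. exact: ler0n. Qed.

Lemma lcoset_len1 : lcoset_len_fun 1 = 0%R.
Proof. by rewrite /lcoset_len_fun tree_distxx. Qed.

Lemma lcoset_lenV g : lcoset_len_fun g^-1 = lcoset_len_fun g.
Proof. by rewrite -[g^-1]mulg1 lcoset_len_funE tree_dist_sym. Qed.

Lemma lcoset_lenM g h :
  (lcoset_len_fun (g * h) <= lcoset_len_fun g + lcoset_len_fun h)%R.
Proof.
have -> : lcoset_len_fun h =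
    (tree_dist (lcoset_pi g : lcoset_tree) (lcoset_pi (g * h)))%:R%R.
  by rewrite -lcoset_len_funE mulKg.
by rewrite -natrD ler_nat; exact: tree_dist_triangle.
Qed.

Definition lcoset_len : length_function R G :=
  LengthFunction lcoset_len_ge0 lcoset_len1 lcoset_lenV lcoset_lenM.

(** Two elements are at distance 0 exactly when they lie in the same left coset of S, so the metric
    quotient is the vertex set G/S. *)
Lemma lcoset_isometric :
  isometric (metric_quotient (left_dist lcoset_len))
    (tree_vertices lcoset_tree).
Proof.
pose d := left_dist lcoset_len.
pose f (u : metric_quotient d) : lcoset :=
  lcoset_pi (repr (u : {eq_quot dist0_equiv d})).
have fd u v : (tree_dist (f u : lcoset_tree) (f v))%:R%R = mdist u v.
  by rewrite -lcoset_len_funE.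
have fpi g : f (mq_pi d g) = lcoset_pi g.
  apply: (@tree_dist_eq0 lcoset_tree); apply/eqP; rewrite -(eqr_nat R).
  rewrite -lcoset_len_funE; apply/eqP.
  have : dist0_equiv d (repr (\pi_{eq_quot dist0_equiv d} g)) g.
    by apply/eqmodP; rewrite reprK.
  by move=> /eqP.
exists f; split; last by move=> u v; exact: fd.
exists (fun v => mq_pi d (lcoset_repr v)) => [u|v]; last first.
  by rewrite fpi lcoset_reprK.
by apply: mdist_positivity; rewrite -fd fpi lcoset_reprK tree_distxx.
Qed.

(** * The degree of the coset tree *)

Definition lcoset_nbrs (u : lcoset) : set lcoset :=
  [set v | parent_adj lcoset_par u v].

Lemma lcoset_nbrs_act g u :
  lcoset_nbrs (lcoset_act g u) = lcoset_act g @` lcoset_nbrs u.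
Proof.
apply/seteqP; split=> [v uv|_ [v uv <-]];
  last by rewrite /lcoset_nbrs /= lcoset_act_adj.
have gV : lcoset_act g (lcoset_act g^-1 v) = v.
  by rewrite -{1}[g]invgK lcoset_actK.
exists (lcoset_act g^-1 v) => //.
by rewrite /lcoset_nbrs /= -(lcoset_act_adj g) gV.
Qed.

Lemma card_lcoset_nbrs u :
  (lcoset_nbrs u #= lcoset_nbrs (lcoset_pi 1))%card.
Proof.
rewrite -[u]lcoset_reprK -[lcoset_repr u]mulg1 -lcoset_act_pi lcoset_nbrs_act.
by apply: inj_card_eq => x y _ _; exact: (can_inj (lcoset_actK _)).
Qed.

(** A coset g S is a child of S exactly when [g * t^-1] is in S, that is, when g is in S t. *)
Lemma lcoset_nbrs1 :
  lcoset_nbrs (lcoset_pi 1) =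
  lcoset_par (lcoset_pi 1) |` [set lcoset_pi (s * t) | s in S].
Proof.
apply/seteqP; split=> v.
  move=> /orP[/eqP <-|/eqP v1]; [by left|right].
  move: v1; rewrite -[v]lcoset_reprK lcoset_par_pi => /lcoset_piP Sv.
  exists (lcoset_repr v * t^-1); last by rewrite mulgVK.
  by have [_ _ SV] := Sg; move: Sv; rewrite mulg1 => /SV; rewrite invgK.
move=> [->|[s Ss <-]]; apply/orP; first by left.
right; apply/eqP; rewrite lcoset_par_pi mulgK; apply/lcoset_piP.
by rewrite mulg1; case: Sg => _ _; apply.
Qed.

(** The parent and the children t S and s t S of the base vertex are distinct: the level separates
    the parent, at -1, from the children, at 1, and the assumption on s separates the children. *)
Lemma lcoset_nbrs_ge3 r s :
  S s -> ~ S (t^-1 * s * t) -> (lcoset_nbrs (lcoset_pi 1) #= `I_r)%card ->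
  (3 <= r)%N.
Proof.
move=> Ss nSs Nr.
have fN : finite_set (lcoset_nbrs (lcoset_pi 1)) by apply/finite_setP; exists r.
rewrite -(card_fset_set Nr).
have [S1 _ _] := Sg.
pose c := [:: lcoset_par (lcoset_pi 1); lcoset_pi t; lcoset_pi (s * t)].
apply: (@uniq_leq_size _ c).
  have lpar x : S x -> lcoset_par (lcoset_pi 1) != lcoset_pi (x * t).
    move=> Sx; apply/eqP => /(congr1 lcoset_lev).
    rewrite lcoset_par_pi mul1g !lcoset_lev_pi lamM lamV (lamS Sx) lamt.
    by lia.
  rewrite /= !inE negb_or lpar// -{1}[t]mul1g lpar//= andbT.
  by apply/eqP => /lcoset_piP; rewrite mulgA.
move=> v vc; rewrite in_fset_set// inE lcoset_nbrs1.
move: vc; rewrite !inE => /or3P[/eqP->|/eqP->|/eqP->]; [by left| |].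
  by right; exists 1 => //; rewrite mul1g.
by right; exists s.
Qed.

End CosetTree.

(** * Compact open base groups and contracting actions *)

Lemma ascending_tree (R : realType) (G : topGroupType) (S : set G) (t s : G)
    (lam : G -> int) :
  subgroup S -> compact S -> nbhs 1 S ->
  (forall x, S x -> S (t * x * t^-1)) ->
  {morph lam : x y / x * y >-> (x + y)%R} ->
  (forall x, S x -> lam x = 0%R) -> lam t = 1%R ->
  (forall g, exists m n, S (t ^+ m * g * t ^- n)) ->
  S s -> ~ S (t^-1 * s * t) ->
  exists (r : nat) (l : length_function R G) (T : tree),
    [/\ (3 <= r)%N, proper_length l, regular r T &
        isometric (metric_quotient (left_dist l)) (tree_vertices T)].
Proof.
move=> Sg Sc S1 tS lamM lamS lamt Sabs Ss nSs.
pose T := lcoset_tree Sg tS lamM lamS lamt Sabs.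
pose l := lcoset_len Sg tS lamM lamS lamt Sabs R.
have fN1 : finite_set (lcoset_nbrs t (lcoset_pi Sg 1)).
  rewrite lcoset_nbrs1// finite_setU; split; first exact: finite_set1.
  (* The child x t S depends only on the class of x modulo [t S t^-1], so it is locally constant on
     the compact set S. *)
  apply: compact_locally_constant_finite => // x Sx.
  have c : (t^-1 * (x^-1 * y) * t) @[y --> x] --> t^-1 * (x^-1 * x) * t.
    apply: cvg_mulg; last exact: cvg_cst.
    by apply: cvg_mulg; [exact: cvg_cst|exact: (@mulgl_continuous G x^-1 x)].
  have : \forall y \near x, S (t^-1 * (x^-1 * y) * t).
    by apply: c; rewrite mulVg mulg1 mulVg.
  apply: filterS => y /= Sxy; apply/esym/lcoset_piP.
  by rewrite invgM !mulgA -(mulgA t^-1).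
have [r Nr] := iffLR (finite_setP _) fN1.
have rT : regular r T.
  by move=> u; exact: card_eq_trans (card_lcoset_nbrs tS u) Nr.
exists r, l, T; split=> //; last exact: lcoset_isometric.
  exact: (lcoset_nbrs_ge3 tS lamM lamS lamt Ss nSs Nr).
move=> n.
(* The elements of length at most n form the union of the cosets that are vertices of the n-ball
   around S: finitely many, each compact. *)
pose B := [set v : T | (tree_dist (lcoset_pi Sg 1 : T) v <= n)%N].
have fB : finite_set B.
  by apply: finite_tree_ball => u; apply/finite_setP; exists r; exact: rT.
pose C (v : T) := [set lcoset_repr v * x | x in S].
have Ccpt v : compact (C v).
  apply: continuous_compact Sc.
  by apply: continuous_subspaceT; exact: mulgl_continuous.
(* G is not assumed Hausdorff, so closedness of the cosets is drawn from S being an open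
   subgroup. *)
have Ccl v : closed (C v).
  have -> : C v = [set x | S ((lcoset_repr v)^-1 * x)].
    apply/seteqP; split=> [_ [x Sx <-]|x Sx]; first by rewrite /= mulKg.
    by exists ((lcoset_repr v)^-1 * x); rewrite ?mulVKg.
  apply: (@closed_comp _ _ (fun x => (lcoset_repr v)^-1 * x) S).
    by move=> x _; exact: mulgl_continuous.
  exact: nbhs1_subgroup_closed.
exists (\bigcup_(v in B) C v).
  move=> g; rewrite /= ler_nat => gn; exists (lcoset_pi Sg g) => //.
  exists ((lcoset_repr (lcoset_pi Sg g))^-1 * g); last by rewrite mulVKg.
  exact: lcoset_pi_repr.
split; last exact: closed_bigcup.
by rewrite -bigsetU_fset_set//; apply: bigsetU_compact.
Qed.

Theorem proposition6 (R : realType) (H : topGroupType) (a : zaction H) :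
  hausdorff_space H -> locally_compact [set: H]%classic ->
  totally_disconnected [set: H]%classic -> ~ compact [set: H]%classic ->
  contracting a ->
  exists (r : nat) (l : length_function R (semidirect a)) (T : tree),
    [/\ (3 <= r)%N, proper_length l, regular r T &
        isometric (metric_quotient (left_dist l)) (tree_vertices T)].
Proof.
move=> Hh Hlc Htd Hnc Hc.
have [K [Kc K1 [K_1 KM KV] aK Kabs]] := contracted_open_subgroup Hh Hlc Htd Hc.
have [s Ks nKs] : exists2 s, K s & ~ K (a (- 1)%R s).
  apply: contrapT => nK; apply: Hnc.
  have KN x : K x -> K (a (- 1)%R x).
    by move=> Kx; apply: contrapT => nKx; apply: nK; exists x.
  suff -> : [set: H] = K by [].
  (* Some forward translate of x is in K, and K is stable under [a (- 1)], which brings it back to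
     x. *)
  apply/seteqP; split=> // x _; have [n] := Kabs x.
  elim: n => [|n IH]; first by rewrite zact0.
  move=> /KN; rewrite -zactD => Kx; apply: IH.
  by congr (K (a _ x)): Kx; lia.
pose G : topGroupType := semidirect a.
have aKn (n : nat) x : K x -> K (a n x).
  elim: n x => [|n IH] x Kx; first by rewrite zact0.
  by rewrite -addn1 PoszD zactD; apply: IH; exact: aK.
(* S is the copy of K inside G, and conjugation by t acts on it as [a 1]. *)
pose S : set G := [set x | x.1 = 0%R /\ K x.2].
pose t : G := (1%R, 1).
have GM (x y : G) : x * y = ((x.1 + y.1)%R, x.2 * a x.1 y.2) by [].
have GV (x : G) : x^-1 = ((- x.1)%R, a (- x.1)%R x.2^-1) by [].
have tn (n : nat) : t ^+ n = (Posz n, 1).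
  elim: n => [//|n IH]; rewrite expgS IH GM /= zact1 mulg1.
  by congr (_, _); lia.
apply: (@ascending_tree R G S t ((0%R, s) : G) (fun x => x.1)).
- split=> [|x y [x1 Kx] [y1 Ky]|x [x1 Kx]]; first by [].
    by rewrite GM /S /= x1 y1 zact0; split=> //; exact: KM.
  by rewrite GV /S /= x1 oppr0 zact0; split=> //; exact: KV.
- exact: (@compact_setX (discrete_topology int) H [set 0%R] K
    (@compact_set1 _ _) Kc).
- exists ([set 0%R : discrete_topology int], K) => //.
  by split=> //; exact: discrete_set1.
- move=> x [x1 Kx]; rewrite !GM GV /S /= x1 invg1 !zact1 mulg1 mul1g addr0.
  rewrite subrr.
  by split=> //; exact: aK.
- by move=> x y; rewrite GM.
- by move=> x [].
- by [].
- move=> g; have [n Kn] := Kabs g.2.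
  (* With m the first witness, the conjugated element has second component [a m g.2], in K because m
     is at least n. As [m + g.1] is nonnegative, its absolute value, the second witness, cancels the
     first component. *)
  exists (n + `|g.1|)%N, `|(Posz (n + `|g.1|) + g.1)%R|%N.
  rewrite !tn GV !GM /S /= invg1 !zact1 mulg1 mul1g; split; first by lia.
  by rewrite addnC PoszD zactD; exact: aKn.
- by split.
by rewrite GV !GM /S /= => -[_]; rewrite invg1 !zact1 mul1g mulg1.
Qed.
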